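(* Let $p$ be a prime. For all $x\in\mathbb{Z}_p\cup B(0;1^-)$, $$\operatorname{Log}\Gamma_p(x)=\operatorname{Log}\Gamma_{\mathrm{M}}(x).$$
   Context: $\mathbb{C}_p$ is the completion of the algebraic closure of $\mathbb{Q}_p$, with absolute value $|\cdot|_p$, and $B(0;1^-)=\{x\in\mathbb{C}_p:|x|_p<1\}$. $\log_p:\mathbb{C}_p^*\to\mathbb{C}_p$ is the Iwasawa $p$-adic logarithm: the homomorphism given by the usual power series of the logarithm on $\{|x-1|_p<1\}$ and normalized by $\log_p(p)=0$. The Volkenborn integral of $g:\mathbb{Z}_p\to\mathbb{C}_p$ is $\int_{\mathbb{Z}_p}g(t)\,dt:=\lim_{N\to\infty}p^{-N}\sum_{j=0}^{p^N-1}g(j)$ when the limit exists. $\chi:\mathbb{C}_p\to\{0,1\}$ is the characteristic function of $\{x\in\mathbb{C}_p:|x|_p\ge1\}$, and $\chi_{\mathbb{Z}_p^*}$ is the characteristic function of the units $\mathbb{Z}_p^*$. Any integrand containing a vanishing characteristic function factor is understood to be $0$. The function $\operatorname{Log}\Gamma_p:\mathbb{C}_p\to\mathbb{C}_p$ is $\operatorname{Log}\Gamma_p(x):=\int_{\mathbb{Z}_p}(x+t)\big(\log_p(x+t)-1\big)\chi(x+t)\,dt$. Morita's function $\operatorname{Log}\Gamma_{\mathrm{M}}$ is defined on $\mathbb{Z}_p$ by $$\operatorname{Log}\Gamma_{\mathrm{M}}(x):=\int_{\mathbb{Z}_p}(x+t)\big(\log_p(x+t)-1\big)\chi_{\mathbb{Z}_p^*}(x+t)\,dt\qquad(x\in\mathbb{Z}_p)$$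 (it is a known fact that this equals $\log_p\Gamma_{\mathrm{M}}(x)$, where $\Gamma_{\mathrm{M}}:\mathbb{Z}_p\to\mathbb{Z}_p^*$ is Morita's $p$-adic gamma function, the continuous extension of $n\mapsto(-1)^n\prod_{1\le j<n,\,p\nmid j}j$, $n\in\mathbb{N}$), and on $B(0;1^-)$ by the convergent power series $$\operatorname{Log}\Gamma_{\mathrm{M}}(x):=\lambda_1x+\sum_{n=1}^{\infty}\frac{(-1)^{n+1}\lambda_{n+1}}{n(n+1)}x^{n+1}\qquad(x\in B(0;1^-)),$$ where $\lambda_1:=\int_{\mathbb{Z}_p}\chi_{\mathbb{Z}_p^*}(t)\log_p(t)\,dt$ and $\lambda_{n+1}:=\int_{\mathbb{Z}_p}\chi_{\mathbb{Z}_p^*}(t)\,t^{-n}\,dt$ for $n\in\mathbb{N}=\{1,2,\dots\}$. It is known that the series converges on $B(0;1^-)$ and that the two definitions agree on $p\mathbb{Z}_p=\mathbb{Z}_p\cap B(0;1^-)$. *)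

(* Defs.v *)
From HB Require Import structures.
From mathcomp Require Import all_boot all_order all_algebra.
From mathcomp Require Import all_classical all_reals all_analysis.
Set Implicit Arguments.
Unset Strict Implicit.
Unset Printing Implicit Defensive.
Import Order.TTheory GRing.Theory Num.Theory.
Import numFieldNormedType.Exports.
Local Open Scope classical_set_scope.
Local Open Scope ring_scope.

(* The norms of MathComp satisfy `|x *+ n| = `|x| *+ n, which excludes
   non-archimedean absolute values, so absolute values are plain functions
   v : K -> R here and convergence in K is convergence to 0 in R of the
   distances. *)
Definition absolute_value (R : realType) (K : fieldType) (v : K -> R) : Prop :=
  [/\ forall x, 0 <= v x,
      forall x, v x = 0 <-> x = 0,
      forall x y, v (x * y) = v x * v y
    & forall x y, v (x + y) <= v x + v y].

Definition vcvg (R : realType) (K : fieldType) (v : K -> R)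
    (u : nat -> K) (l : K) : Prop :=
  (fun n => v (u n - l)) @ \oo --> (0 : R).

(* The limit of u if it converges, and 0 otherwise. *)
Definition vlim (R : realType) (K : fieldType) (v : K -> R)
    (u : nat -> K) : K :=
  xget 0 [set l | vcvg v u l].

Definition vcauchy (R : realType) (K : fieldType) (v : K -> R)
    (u : nat -> K) : Prop :=
  forall e : R, 0 < e -> exists N : nat,
    forall m n : nat, (N <= m)%N -> (N <= n)%N -> v (u m - u n) < e.

Definition vcomplete (R : realType) (K : fieldType) (v : K -> R) : Prop :=
  forall u : nat -> K, vcauchy v u -> exists l, vcvg v u l.

Definition is_completion (R : realType) (K L : fieldType)
    (vK : K -> R) (vL : L -> R) (i : {rmorphism K -> L}) : Prop :=
  [/\ absolute_value vL,
      forall a, vL (i a) = vK a,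
      forall (y : L) (e : R), 0 < e -> exists a : K, vL (y - i a) < e
    & vcomplete vL].

Definition is_algebraic_closure (K L : fieldType)
    (i : {rmorphism K -> L}) : Prop :=
  GRing.closed_field_axiom L /\ forall y : L, algebraicOver i y.

Definition padic_abs (R : realType) (p : nat) (x : rat) : R :=
  if x == 0 then 0
  else p%:R ^+ logn p `|denq x|%N / p%:R ^+ logn p `|numq x|%N.

(* C_p, determined up to isometric isomorphism by the tower
   rat -> Q_p -> algebraic closure of Q_p -> C_p. *)
Record complex_padic (R : realType) (p : nat) := ComplexPadic {
  Qp : fieldType;
  absQp : Qp -> R;
  rat_to_Qp : {rmorphism rat -> Qp};
  Qp_completion : is_completion (@padic_abs R p) absQp rat_to_Qp;
  Qpbar : fieldType;
  absQpbar : Qpbar -> R;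
  Qp_to_Qpbar : {rmorphism Qp -> Qpbar};
  Qpbar_closure : is_algebraic_closure Qp_to_Qpbar;
  absQpbar_absolute_value : absolute_value absQpbar;
  absQpbar_extends : forall a, absQpbar (Qp_to_Qpbar a) = absQp a;
  Cp :> fieldType;
  absCp : Cp -> R;
  Qpbar_to_Cp : {rmorphism Qpbar -> Cp};
  Cp_completion : is_completion absQpbar absCp Qpbar_to_Cp }.

Section PadicFunctions.
Variables (R : realType) (p : nat) (C : complex_padic R p).
Local Notation absC := (@absCp R p C).

Definition padic_integers : set C :=
  [set x | exists2 a : Qp C,
     Qpbar_to_Cp C (Qp_to_Qpbar C a) = x & absQp a <= 1].

Definition padic_units : set C :=
  [set x | padic_integers x /\ exists2 y, padic_integers y & x * y = 1].

Definition ball01 : set C := [set x | absC x < 1].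

Definition iwasawa_log (logp : C -> C) : Prop :=
  [/\ forall x y, x != 0 -> y != 0 -> logp (x * y) = logp x + logp y,
      forall x, absC (x - 1) < 1 ->
        vcvg absC (series (fun n => (-1) ^+ n * (x - 1) ^+ n.+1 / n.+1%:R))
             (logp x)
    & logp p%:R = 0].

(* Only the values of g at natural numbers matter, so integrands on Z_p are
   given as functions on C_p. *)
Definition volkenborn (g : C -> C) : C :=
  vlim absC (fun N => (p%:R ^+ N)^-1 * \sum_(0 <= j < p ^ N) g j%:R).

Definition LogGammap (logp : C -> C) (x : C) : C :=
  volkenborn (fun t => (x + t) * (logp (x + t) - 1) *
                       \1_[set y | 1 <= absC y] (x + t)).

(* Morita's function is given by one formula on Z_p and another on B(0;1^-). *)
Definition LogGammaM_Zp (logp : C -> C) (x : C) : C :=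
  volkenborn (fun t => (x + t) * (logp (x + t) - 1) * \1_padic_units (x + t)).

Definition lambda1 (logp : C -> C) : C :=
  volkenborn (fun t => \1_padic_units t * logp t).

(* lambdaS n is lambda_{n+1}, for n >= 1. *)
Definition lambdaS (n : nat) : C :=
  volkenborn (fun t => \1_padic_units t * t ^- n).

(* The n-th term of the series, n >= 0, is the (n+1)-st of the usual one. *)
Definition LogGammaM_ball (logp : C -> C) (x : C) : C :=
  lambda1 logp * x +
  vlim absC (series (fun n =>
    (-1) ^+ n.+2 * lambdaS n.+1 / (n.+1 * n.+2)%:R * x ^+ n.+2)).

End PadicFunctions.

(* Main.v *)
Require Import Defs.
From HB Require Import structures.
From mathcomp Require Import all_boot all_order all_algebra.
From mathcomp Require Import all_classical all_reals all_analysis.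
From mathcomp Require Import ring lra zify.
Set Implicit Arguments.
Unset Strict Implicit.
Unset Printing Implicit Defensive.
Import Order.TTheory GRing.Theory Num.Theory.
Import numFieldNormedType.Exports.
Local Open Scope classical_set_scope.
Local Open Scope ring_scope.

(** On Z_p the two integrands coincide pointwise, since there |y| >= 1 means
    that y is a unit.

    On |x| < 1, only the j prime to p contribute to the averages of the first
    integrand. With f(u) = u (log u - 1),
      f(x + j) = f(j) + x log j
                 + sum_(n >= 1) (-1)^(n+1) x^(n+1) j^(-n) / (n(n+1)),
    so the N-th average splits into those of f, of log and of j^(-n). Those of
    f tend to 0 because f is odd (log (-1) = 0): j and p^N - j almost cancel.
    Those of log and of j^(-n) converge by comparing the levels N and N+1 with
    a first-order expansion; the rate obtained for j^(-n) is O(p^(-N))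
    uniformly in n, while |x^(n+1) / (n(n+1))| is bounded, so the limit in N
    goes through the series. *)

(** * Real bounds on n t^n *)

(** The left side decreases with n: consecutive values differ by (n + 1) (1 - t)^2 t^n. *)
Lemma natr_expr_le (R : realFieldType) (t : R) (n : nat) :
  0 <= t <= 1 -> (n%:R * (1 - t) + 1) * t ^+ n <= 1.
Proof.
move=> /andP[t0 t1]; elim: n => [|n IH]; first by rewrite mul0r add0r mulr1.
have tn0 : 0 <= t ^+ n by rewrite exprn_ge0.
have n0 : 0 <= n%:R * (1 - t) by rewrite mulr_ge0 ?ler0n ?subr_ge0.
apply: le_trans IH; rewrite exprS mulrA ler_wpM2r// -natr1; nra.
Qed.

Lemma natrS_expr_le (R : realFieldType) (t : R) (n : nat) :
  0 <= t < 1 -> n.+1%:R * t ^+ n <= (1 - t)^-1.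
Proof.
move=> /andP[t0 t1]; rewrite -[leRHS]mulr1 ler_pdivlMl ?subr_gt0// mulrA -natr1.
have := @natr_expr_le _ t n; rewrite t0 ltW// => /(_ isT).
have : 0 <= t ^+ n by rewrite exprn_ge0.
nra.
Qed.

Lemma cvg_natr_expr (R : realType) (t : R) :
  0 <= t < 1 -> (fun n => n.+1%:R * t ^+ n) @ \oo --> (0 : R).
Proof.
(* With s^2 = t, the term is ((n + 1) s^n) s^n, whose first factor is bounded. *)
move=> /andP[t0 t1]; pose s := Num.sqrt t.
have s0 : 0 <= s by rewrite sqrtr_ge0.
have s1 : s < 1 by rewrite -sqrtr1 ltr_sqrt.
apply: (@squeeze_cvgr _ _ _ _ (fun=> 0) (fun n => (1 - s)^-1 * s ^+ n)).
- near=> n; rewrite mulr_ge0 ?ler0n ?exprn_ge0//=.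
  rewrite -(sqr_sqrtr t0) -exprM mulnC exprM expr2 mulrA ler_wpM2r ?exprn_ge0//.
  by rewrite natrS_expr_le ?s0.
- exact: cvg_cst.
- rewrite -[X in _ --> X](mulr0 (1 - s)^-1); apply: cvgMr.
  by apply: cvg_expr; rewrite ger0_norm.
Unshelve. all: by end_near.
Qed.

(** * Convergence for an absolute value, and the ultrametric case *)

Section AbsoluteValue.
Context (R : realType) (K : fieldType) (v : K -> R).
Hypothesis absv : absolute_value v.

Lemma absv_ge0 x : 0 <= v x. Proof. by case: absv. Qed.

Lemma absv_eq0 x : (v x == 0) = (x == 0).
Proof. by case: absv => _ v0 _ _; apply/eqP/eqP => /v0. Qed.

Lemma absv0 : v 0 = 0. Proof. by apply/eqP; rewrite absv_eq0. Qed.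

Lemma absvM : {morph v : x y / x * y}. Proof. by case: absv. Qed.

Lemma ler_absvD x y : v (x + y) <= v x + v y. Proof. by case: absv. Qed.

Lemma absv1 : v 1 = 1.
Proof.
have v1 : v 1 != 0 by rewrite absv_eq0 oner_eq0.
by apply: (mulfI v1); rewrite -absvM !mulr1.
Qed.

Lemma absvX n : {morph v : x / x ^+ n}.
Proof. by move=> x; elim: n => [|n IH]; rewrite ?absv1// !exprS absvM IH. Qed.

Lemma absvV x : v x^-1 = (v x)^-1.
Proof.
have [->|x0] := eqVneq x 0; first by rewrite !(invr0, absv0).
have vx0 : v x != 0 by rewrite absv_eq0.
by apply: (mulfI vx0); rewrite -absvM !divff// absv1.
Qed.

Lemma absvN x : v (- x) = v x.
Proof.
suff vN1 : v (-1) = 1 by rewrite -mulN1r absvM vN1 mul1r.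
by apply/eqP; rewrite -sqrp_eq1 ?absv_ge0// -absvX sqrrN expr1n absv1.
Qed.

Lemma absvB x y : v (x - y) = v (y - x).
Proof. by rewrite -absvN opprB. Qed.

Lemma vcvgP (u : nat -> K) l : vcvg v u l <->
  forall e, 0 < e -> exists N, forall n, (N <= n)%N -> v (u n - l) < e.
Proof.
rewrite /vcvg; split=> [/cvgr0Pnorm_lt ul e /ul [N _ uN]|ul].
  by exists N => n Nn; rewrite -[ltLHS]ger0_norm ?absv_ge0//; apply: uN.
apply/cvgr0Pnorm_lt => e /ul [N uN]; exists N => // n /= Nn.
by rewrite ger0_norm ?absv_ge0//; apply: uN.
Qed.

Lemma vcvg_le (u : nat -> K) l (b : nat -> R) :
  (forall n, v (u n - l) <= b n) -> b @ \oo --> (0 : R) -> vcvg v u l.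
Proof.
move=> ub b0; apply: (@squeeze_cvgr _ _ _ _ (fun=> 0) b) => //.
  by near=> n; rewrite absv_ge0 ub.
exact: cvg_cst.
Unshelve. all: by end_near.
Qed.

Lemma vcvg_shift (u : nat -> K) l :
  vcvg v (fun n => u n.+1) l <-> vcvg v u l.
Proof. by rewrite /vcvg -(cvg_shiftS (fun n => v (u n - l))). Qed.

Lemma vcvg_cst a : vcvg v (fun=> a) a.
Proof. by rewrite /vcvg subrr absv0; apply: cvg_cst. Qed.

Lemma vcvgD (u w : nat -> K) l m :
  vcvg v u l -> vcvg v w m -> vcvg v (fun n => u n + w n) (l + m).
Proof.
move=> ul wm; apply: (@vcvg_le _ _ (fun n => v (u n - l) + v (w n - m))).
  by move=> n; rewrite opprD addrACA ler_absvD.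
by rewrite -[X in _ --> X](addr0 0); apply: cvgD.
Qed.

Lemma vcvgZ a (u : nat -> K) l :
  vcvg v u l -> vcvg v (fun n => a * u n) (a * l).
Proof.
move=> ul; apply: (@vcvg_le _ _ (fun n => v a * v (u n - l))).
  by move=> n; rewrite -mulrBr absvM.
by rewrite -[X in _ --> X](mulr0 (v a)); apply: cvgMr.
Qed.

Lemma vcvg_sum (I : Type) (r : seq I) (P : pred I) (u : I -> nat -> K)
    (l : I -> K) : (forall i, P i -> vcvg v (u i) (l i)) ->
  vcvg v (fun n => \sum_(i <- r | P i) u i n) (\sum_(i <- r | P i) l i).
Proof.
move=> ul; elim: r => [|i r IH].
  rewrite big_nil; under eq_fun do rewrite big_nil.
  exact: vcvg_cst.
rewrite big_cons; under eq_fun do rewrite big_cons.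
by case: ifPn => // Pi; apply: vcvgD => //; apply: ul.
Qed.

Lemma vcvg_bound (u : nat -> K) l c B :
  vcvg v u l -> (forall n, v (u n - c) <= B) -> v (l - c) <= B.
Proof.
move=> /vcvgP ul uB; apply/ler_addgt0Pr => e /ul[N /(_ N (leqnn N)) uN].
rewrite -(subrK (u N) l) -addrA addrC.
by apply: le_trans (ler_absvD _ _) _; rewrite lerD// absvB ltW.
Qed.

Lemma vcvg_unique (u : nat -> K) l m : vcvg v u l -> vcvg v u m -> l = m.
Proof.
move=> ul um; apply/eqP; rewrite -subr_eq0 -absv_eq0; apply/eqP.
have : vcvg v (fun=> 0) (l - m).
  have /(vcvgD ul) := vcvgZ (-1) um.
  by under eq_fun do rewrite mulN1r subrr; rewrite mulN1r.
rewrite /vcvg sub0r absvN => h; exact: cvg_unique (cvg_cst _) h.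
Qed.

Lemma vlimE (u : nat -> K) l : vcvg v u l -> vlim v u = l.
Proof. by move=> ul; apply: xget_unique => // m /vcvg_unique; apply. Qed.

(* Expanding (x + y)^n gives v(x + y)^n <= (n + 1) max(v x, v y)^n. *)
Lemma nonarchimedean : (forall n, v n%:R <= 1) ->
  forall x y, v (x + y) <= Num.max (v x) (v y).
Proof.
move=> vn x y; set M := Num.max _ _; rewrite leNgt; apply/negP => Mv.
have M0 : 0 <= M by rewrite le_max absv_ge0.
have v0 : 0 < v (x + y) by rewrite (le_lt_trans M0).
(* Here t < 1, while [vX] gives 1 <= (n + 1) t^n for all n, against [cvg_natr_expr]. *)
pose t := M / v (x + y).
have t01 : 0 <= t < 1 by rewrite divr_ge0 ?absv_ge0//= ltr_pdivrMr// mul1r.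
have vX n : v (x + y) ^+ n <= n.+1%:R * M ^+ n.
  rewrite -absvX exprDn.
  apply: (@le_trans _ _ (\sum_(i < n.+1) v (x ^+ (n - i) * y ^+ i *+ 'C(n, i)))).
    elim/big_rec2 : _ => [|i a b _ ba]; first by rewrite absv0.
    by rewrite (le_trans (ler_absvD _ _))// lerD2l.
  rewrite mulr_natl -[X in _ *+ X]card_ord -sumr_const; apply: ler_sum => i _.
  rewrite -mulr_natr !absvM !absvX -[leRHS]mulr1.
  apply: ler_pM; rewrite ?mulr_ge0 ?exprn_ge0 ?absv_ge0//.
  rewrite -[X in _ <= M ^+ X](subnK (leq_ord i)) exprD.
  by apply: ler_pM; rewrite ?exprn_ge0 ?absv_ge0// lerXn2r ?nnegrE ?absv_ge0//
    le_max lexx ?orbT.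
have /cvgr0Pnorm_lt/(_ _ ltr01)[N _ /(_ N (leqnn N))] := cvg_natr_expr t01.
rewrite /= expr_div_n mulrA ger0_norm; last first.
  by rewrite divr_ge0 ?mulr_ge0 ?exprn_ge0 ?absv_ge0 ?ler0n.
by rewrite ltr_pdivrMr ?exprn_gt0// mul1r ltNge vX.
Qed.

Hypothesis ultra : forall x y, v (x + y) <= Num.max (v x) (v y).

Lemma absvD_le x y B : v x <= B -> v y <= B -> v (x + y) <= B.
Proof. by move=> xB yB; rewrite (le_trans (ultra _ _))// ge_max xB. Qed.

Lemma absvB_le x y B : v x <= B -> v y <= B -> v (x - y) <= B.
Proof. by move=> xB yB; rewrite absvD_le ?absvN. Qed.

Lemma absv_sum_le (I : eqType) (r : seq I) (P : pred I) (F : I -> K) B :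
  0 <= B -> (forall i, i \in r -> P i -> v (F i) <= B) ->
  v (\sum_(i <- r | P i) F i) <= B.
Proof.
move=> B0 FB; rewrite big_seq_cond.
elim/big_ind : _ => [|x y|i /andP[ir Pi]]; first by rewrite absv0.
- exact: absvD_le.
- exact: FB.
Qed.

Lemma absvD_eq x y : v x < v y -> v (x + y) = v y.
Proof.
move=> xy; apply/eqP; rewrite eq_le absvD_le ?(ltW xy)//=.
rewrite leNgt; apply/negP => xyy; have := ultra (- x) (x + y).
by rewrite addKr absvN leNgt gt_max xy xyy.
Qed.

(** A distance between two terms is at most the largest of the steps between them; e / 2 keeps the
    final inequality strict. *)
Lemma ultra_vcauchy (u : nat -> K) :
  vcvg v (fun n => u n.+1 - u n) 0 -> vcauchy v u.
Proof.
move=> /vcvgP u0 e e0; have e2 : 0 < e / 2 by rewrite divr_gt0.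
have [N uN] := u0 _ e2; exists N.
have uNd d : v (u (N + d)%N - u N) <= e / 2.
  elim: d => [|d IH]; first by rewrite addn0 subrr absv0 ltW.
  rewrite -(subrK (u (N + d)%N) (u _)) -addrA absvD_le// addnS.
  by rewrite -[X in v X]subr0 ltW// uN// leq_addr.
move=> m n /subnKC<- /subnKC<-.
apply: (@le_lt_trans _ _ (e / 2)); last by rewrite ltr_pdivrMr// ltr_pMr// ltr1n.
rewrite -(subrK (u N) (u _)) -addrA absvD_le// absvB; exact: uNd.
Qed.

Lemma ultra_series_cvg (a : nat -> K) : vcomplete v ->
  vcvg v a 0 -> vcvg v (series a) (vlim v (series a)).
Proof.
move=> cv a0; suff [l sl] : exists l, vcvg v (series a) l by rewrite (vlimE sl).
apply/cv/ultra_vcauchy; under eq_fun do rewrite /series/= big_nat_recr//= addrAC subrr add0r.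
exact: a0.
Qed.

End AbsoluteValue.

(** * The absolute value of C_p on natural numbers *)

Section ComplexPadic.
Context (R : realType) (p : nat) (p_pr : prime p) (C : complex_padic R p).
Local Notation v := (@absCp R p C).
Local Notation q := (p%:R^-1 : R).

Lemma absCp_absolute_value : absolute_value v.
Proof. by case: (Cp_completion C). Qed.
Local Notation absv := absCp_absolute_value.

Lemma absCp_Qp (a : Qp C) : v (Qpbar_to_Cp C (Qp_to_Qpbar C a)) = absQp a.
Proof. by case: (Cp_completion C) => _ -> _ _; rewrite absQpbar_extends. Qed.

Lemma absCp_natr n : (0 < n)%N -> v n%:R = q ^+ logn p n.
Proof.
move=> n0.
have <- : Qpbar_to_Cp C (Qp_to_Qpbar C (rat_to_Qp C n%:R)) = n%:R.
  by rewrite !rmorph_nat.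
rewrite absCp_Qp; case: (Qp_completion C) => _ -> _ _.
rewrite /padic_abs pnatr_eq0 gtn_eqF// (pmulrn (1 : rat)) numq_int denq_int !absz_nat.
by rewrite logn1 expr0 mul1r exprVn.
Qed.

Lemma invp_gt0 : 0 < q. Proof. by rewrite invr_gt0 ltr0n prime_gt0. Qed.

Lemma invp_ge0 : 0 <= q. Proof. exact: ltW invp_gt0. Qed.

Lemma invp_le_half : q <= 2^-1.
Proof. by rewrite lef_pV2 ?posrE ?ltr0n ?prime_gt0// ler_nat prime_gt1. Qed.

Lemma invp_lt1 : q < 1. Proof. by have := invp_le_half; lra. Qed.

Lemma invp_le1 : q <= 1. Proof. exact: ltW invp_lt1. Qed.

Lemma invpX_ge0 n : 0 <= q ^+ n. Proof. by rewrite exprn_ge0// invp_ge0. Qed.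

Lemma invpX_le1 n : q ^+ n <= 1.
Proof. by rewrite exprn_ile1 ?invp_le1// invp_ge0. Qed.

Lemma cvg_invpX (B : R) : (fun n => B * q ^+ n) @ \oo --> (0 : R).
Proof.
rewrite -[X in _ --> X](mulr0 B); apply: cvgMr; apply: cvg_expr.
by rewrite ger0_norm ?invp_ge0 ?invp_lt1.
Qed.

Lemma absCp_p : v p%:R = q.
Proof. by rewrite absCp_natr ?prime_gt0// logn_prime// eqxx expr1. Qed.

Lemma absCp_natr_le1 n : v n%:R <= 1.
Proof.
case: n => [|n]; first by rewrite (absv0 absv).
by rewrite absCp_natr// invpX_le1.
Qed.

(** [absolute_value] grants only the triangle inequality; the ultrametric one comes from the values
    at natural numbers. *)
Lemma absCpD_le_max x y : v (x + y) <= Num.max (v x) (v y).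
Proof. exact: nonarchimedean absv absCp_natr_le1 x y. Qed.
Local Notation ultra := absCpD_le_max.

Lemma natrS_neq0 n : n.+1%:R != 0 :> C.
Proof.
by rewrite -(absv_eq0 absv) absCp_natr// expf_eq0 gt_eqF ?invp_gt0// andbF.
Qed.

Lemma natr_gt0_neq0 n : (0 < n)%N -> n%:R != 0 :> C.
Proof. by case: n => // n _; apply: natrS_neq0. Qed.

Lemma absCp_natr_ndvd n : ~~ (p %| n)%N -> v n%:R = 1.
Proof.
case: n => [|n pn]; first by rewrite dvdn0.
by rewrite absCp_natr// lognE p_pr (negbTE pn) expr0.
Qed.

Lemma absCp_natr_dvd n : (p %| n)%N -> v n%:R <= q.
Proof.
move=> /dvdnP[k ->]; rewrite natrM (absvM absv) absCp_p.
by rewrite ler_piMl ?invp_ge0 ?absCp_natr_le1.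
Qed.

Lemma absCp_natrM_le k N : v (k * p ^ N)%:R <= q ^+ N.
Proof.
rewrite natrM natrX (absvM absv) (absvX absv) absCp_p.
by rewrite ler_piMl ?invpX_ge0 ?absCp_natr_le1.
Qed.

(** The power of p dividing n + 1 is at most n + 1. This crude bound suffices for the denominators
    of the logarithmic series. *)
Lemma absCp_natrV n : v n.+1%:R^-1 <= n.+1%:R.
Proof.
rewrite (absvV absv) absCp_natr// exprVn invrK -natrX ler_nat.
by rewrite dvdn_leq// pfactor_dvdnn.
Qed.

(** * Convergence of the averages over j < p^N *)

(** The index k is the leading base-p digit. *)
Lemma sum_expnS (g : nat -> C) N : \sum_(0 <= j < p ^ N.+1) g j =
  \sum_(0 <= k < p) \sum_(0 <= j < p ^ N) g (j + k * p ^ N)%N.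
Proof.
rewrite expnS big_nat_mul; apply: eq_bigr => k _.
by rewrite -{1}[(k * _)%N]add0n big_addn -mulnBl subSnn mul1n.
Qed.

Definition vavg (g : nat -> C) (N : nat) : C :=
  (p%:R ^+ N)^-1 * \sum_(0 <= j < p ^ N) g j.

(** Only shifts by multiples of p occur: they preserve divisibility by p, so cutting a function off
    to the j prime to p does no harm. *)
Definition padic_lip (B : R) (g : nat -> C) := forall N j k,
  v (g (j + k * p ^ N.+1)%N - g j) <= B * q ^+ N.+1.

(* First-order expansion of [g] with derivative [h]. *)
Definition padic_diff (B : R) (g h : nat -> C) := forall N j k,
  v (g (j + k * p ^ N.+1)%N - g j - (k * p ^ N.+1)%:R * h j)
    <= B * (q ^+ N.+1) ^+ 2.

(* The sum over [j < p ^ N.+2] is p times the previous one up to Lipschitz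
   errors, so each step gains a factor q. *)
Lemma padic_lip_sum (B : R) (g : nat -> C) N : 0 <= B ->
  padic_lip B g -> v (\sum_(0 <= j < p) g j) <= B ->
  v (\sum_(0 <= j < p ^ N.+1) g j) <= B * q ^+ N.
Proof.
move=> B0 lg g1; elim: N => [|N IH]; first by rewrite expn1 mulr1.
rewrite sum_expnS.
rewrite (_ : \sum_(0 <= k < p) _ = \sum_(0 <= k < p) \sum_(0 <= j < p ^ N.+1)
    (g (j + k * p ^ N.+1)%N - g j) + p%:R * \sum_(0 <= j < p ^ N.+1) g j).
  have Bq : 0 <= B * q ^+ N.+1 by rewrite mulr_ge0 ?invpX_ge0.
  apply: (absvD_le ultra).
    by do 2! apply: (absv_sum_le absv ultra) => // ? _ _.
  by rewrite (absvM absv) absCp_p exprS mulrCA ler_wpM2l ?invp_ge0.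
under [in RHS]eq_bigr do rewrite sumrB.
by rewrite sumrB sumr_const_nat subn0 mulr_natl subrK.
Qed.

(** Twice the sum is p (p - 1), and |2| >= 1/2 for every p. *)
Lemma absCp_sum_nat : v (\sum_(0 <= k < p) k%:R) <= 2 * q.
Proof.
have E : (\sum_(0 <= k < p) k%:R : C) * 2%:R = p%:R * p.-1%:R.
  rewrite -natr_sum -!natrM; congr _%:R.
  rewrite bin2_sum bin2 muln2 halfK oddM -[in odd p](prednK (prime_gt0 p_pr)).
  by rewrite /= andNb subn0.
have := congr1 v E; rewrite !(absvM absv) absCp_p => E'.
have := absCp_natrV 1; rewrite (absvV absv).
have := absCp_natr_le1 p.-1; have := invp_gt0; have := absv_ge0 absv p.-1%:R.
have := absv_ge0 absv (\sum_(0 <= k < p) k%:R).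
have : 0 < v 2%:R by rewrite lt_def (absv_ge0 absv) (absv_eq0 absv) natrS_neq0.
set a := v (\sum_(_ <= _ < _) _) in E' *; set b := v 2%:R in E' *.
move=> b0 a0 c0 q0 c1; rewrite invf_ple ?posrE// => b2.
have : a * b <= q by rewrite E' ler_piMr// ltW.
nra.
Qed.

(* The error terms contribute O(q^(2N) / q^N) and the linear terms are
   p^-1 (0 + ... + (p-1)) times a sum of [h], which [padic_lip_sum] bounds; the
   factor 2 is needed only for p = 2. *)
Lemma vavg_step (B : R) (g h : nat -> C) N : 0 <= B ->
  padic_diff B g h -> padic_lip B h -> v (\sum_(0 <= j < p) h j) <= B ->
  v (vavg g N.+2 - vavg g N.+1) <= 2 * B * q ^+ N.
Proof.
move=> B0 dg lh h1; set P := p%:R : C.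
have P0 : P != 0 by rewrite natr_gt0_neq0 ?prime_gt0.
(* [D] gathers the second-order errors. In [DE], the term with factor P becomes [vavg g N.+1] after
   division by P^(N+2) and cancels. *)
set D := \sum_(0 <= k < p) \sum_(0 <= j < p ^ N.+1)
  (g (j + k * p ^ N.+1)%N - g j - (k * p ^ N.+1)%:R * h j).
have DE : \sum_(0 <= j < p ^ N.+2) g j = D + P * \sum_(0 <= j < p ^ N.+1) g j
    + P ^+ N.+1 * (\sum_(0 <= k < p) k%:R) * \sum_(0 <= j < p ^ N.+1) h j.
  rewrite /D sum_expnS.
  under [X in _ = X + _ + _]eq_bigr do rewrite !sumrB -mulr_sumr.
  rewrite !sumrB sumr_const_nat subn0 -(mulr_natl _ p) -/P -mulr_suml.
  under [X in _ = _ - X * _ + _ + _]eq_bigr do rewrite natrM natrX.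
  by rewrite -mulr_suml; ring.
have -> : vavg g N.+2 - vavg g N.+1 = (P ^+ N.+2)^-1 * D +
    P^-1 * (\sum_(0 <= k < p) k%:R) * \sum_(0 <= j < p ^ N.+1) h j.
  by rewrite /vavg DE -/P !exprS; field; rewrite expf_neq0 ?andbT.
apply: (absvD_le ultra).
  rewrite (absvM absv) (absvV absv) (absvX absv) absCp_p.
  rewrite ler_pdivrMl ?exprn_gt0 ?invp_gt0//.
  have : v D <= B * (q ^+ N.+1) ^+ 2.
    have Bq : 0 <= B * (q ^+ N.+1) ^+ 2 by rewrite mulr_ge0 ?exprn_ge0 ?invp_ge0.
    by do 2! apply: (absv_sum_le absv ultra) => // ? _ _.
  move=> /le_trans; apply.
  rewrite (_ : _ * (2 * B * _) = B * (q ^+ N.+1) ^+ 2 * 2); last first.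
    by rewrite !exprS; ring.
  by rewrite ler_peMr ?mulr_ge0 ?exprn_ge0 ?invp_ge0// ler1n.
rewrite !(absvM absv) (absvV absv) absCp_p invrK -mulrA.
rewrite (_ : 2 * B * q ^+ N = p%:R * (2 * q * (B * q ^+ N))).
  rewrite ler_wpM2l// ler_pM ?(absv_ge0 absv) ?absCp_sum_nat//.
  exact: padic_lip_sum.
by field; rewrite pnatr_eq0 -lt0n prime_gt0.
Qed.

(** By the ultrametric inequality the bound on one step also bounds the distance to the limit. The
    rate depends on g only through B, which gives uniformity in families of functions. *)
Lemma vavg_cvg (B : R) (g h : nat -> C) : 0 <= B ->
  padic_diff B g h -> padic_lip B h -> v (\sum_(0 <= j < p) h j) <= B ->
  vcvg v (vavg g) (vlim v (vavg g)) /\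
  forall N, v (vavg g N.+1 - vlim v (vavg g)) <= 2 * B * q ^+ N.
Proof.
move=> B0 dg lh h1; have st N := vavg_step N B0 dg lh h1.
have [l gl] : exists l, vcvg v (vavg g) l.
  have [_ _ _ cC] := Cp_completion C.
  (* [vavg_step] starts at level 1, so the step from level 0 is dropped. *)
  apply/cC/(ultra_vcauchy absv ultra); apply: (proj1 (vcvg_shift _ _ _)).
  apply: (vcvg_le absv) (cvg_invpX (2 * B)) => N; rewrite subr0; exact: st.
rewrite (vlimE absv gl); split=> // N; rewrite (absvB absv).
have : vcvg v (fun n => vavg g (n + N.+1)%N) l.
  elim: N.+1 => [|m IH]; first by under eq_fun do rewrite addn0.
  under eq_fun do rewrite addnS -addSn.
  exact: (proj2 (vcvg_shift _ (fun n => vavg g (n + m)%N) _)).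
move=> /(vcvg_bound absv); apply; elim=> [|n IH].
  by rewrite subrr (absv0 absv) !mulr_ge0 ?invpX_ge0.
rewrite -(subrK (vavg g (n + N.+1)) (vavg g _)) -addrA (absvD_le ultra)//.
rewrite addSn addnS (le_trans (st _))// ler_wpM2l ?mulr_ge0//.
by rewrite exprD ler_piMl ?invpX_ge0 ?invpX_le1.
Qed.

(** * Averages of j^(-n) over j prime to p *)

(** The indicator of the units of Z_p at j (see [indic_padic_units]), as a divisibility test that is
    visibly periodic mod p. *)
Definition chi (j : nat) : C := (~~ (p %| j)%N)%:R.

Lemma chi_shift j k N : chi (j + k * p ^ N.+1) = chi j.
Proof. by rewrite /chi dvdn_addl// expnS mulnCA dvdn_mulr. Qed.

Lemma absCp_exprB_le a b n : v a <= 1 -> v b <= 1 ->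
  v (b ^+ n - a ^+ n) <= v (b - a).
Proof.
move=> a1 b1; elim: n => [|n IH]; first by rewrite subrr (absv0 absv) (absv_ge0 absv).
rewrite (_ : _ - _ = b * (b ^+ n - a ^+ n) + (b - a) * a ^+ n); last first.
  by rewrite !exprS; ring.
apply: (absvD_le ultra); rewrite (absvM absv).
  by rewrite (le_trans _ IH)// ler_piMl ?(absv_ge0 absv).
by rewrite ler_piMr ?(absvX absv) ?exprn_ile1 ?(absv_ge0 absv).
Qed.

Lemma absCp_invB x y : v x = 1 -> v y = 1 -> v (y^-1 - x^-1) = v (y - x).
Proof.
move=> x1 y1.
have x0 : x != 0 by rewrite -(absv_eq0 absv) x1 oner_eq0.
have y0 : y != 0 by rewrite -(absv_eq0 absv) y1 oner_eq0.
rewrite (_ : _ - _ = (x - y) * (x^-1 * y^-1)); last by field; rewrite ?x0 ?y0.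
by rewrite !(absvM absv) !(absvV absv) x1 y1 invr1 !mulr1 (absvB absv).
Qed.

(** First-order expansion of the power -n, by induction on n. The constant is 1 for every n because
    |n| <= 1. *)
Lemma absCp_exprV_taylor x y n : v x = 1 -> v y = 1 ->
  v (y^-1 ^+ n - x^-1 ^+ n + n%:R * (y - x) * x^-1 ^+ n.+1) <= v (y - x) ^+ 2.
Proof.
move=> x1 y1.
have x0 : x != 0 by rewrite -(absv_eq0 absv) x1 oner_eq0.
have y0 : y != 0 by rewrite -(absv_eq0 absv) y1 oner_eq0.
have a1 : v x^-1 = 1 by rewrite (absvV absv) x1 invr1.
have b1 : v y^-1 = 1 by rewrite (absvV absv) y1 invr1.
elim: n => [|n IH].
  by rewrite !expr0 subrr mul0r mul0r addr0 (absv0 absv) exprn_ge0 ?(absv_ge0 absv).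
set E := (X in v X <= _) in IH.
(* Besides y^-1 times the previous error, there is x^-n times the error for exponent 1, and the cost
   of replacing y^-1 by x^-1 in the linear term. *)
rewrite (_ : _ + _ = y^-1 * E + (x^-1 ^+ n * ((y - x) ^+ 2 * (x^-1 ^+ 2 * y^-1))
    - n%:R * (y - x) * x^-1 ^+ n.+1 * (y^-1 - x^-1))); last first.
  by rewrite /E !exprS expr0 -natr1; field; rewrite ?x0 ?y0.
apply: (absvD_le ultra); first by rewrite (absvM absv) b1 mul1r.
apply: (absvB_le absv ultra).
  by rewrite !(absvM absv) !(absvX absv) a1 b1 !expr1n !mul1r mulr1.
rewrite !(absvM absv) !(absvX absv) a1 expr1n mulr1 absCp_invB// -mulrA -expr2.
by rewrite ler_piMl ?exprn_ge0 ?(absv_ge0 absv) ?absCp_natr_le1.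
Qed.

Definition chiV n (j : nat) : C := chi j * j%:R ^- n.

Lemma absCp_chiV_le1 n j : v (chiV n j) <= 1.
Proof.
rewrite /chiV /chi; case: (boolP (p %| j)%N) => pj; rewrite ?mul0r ?(absv0 absv)//.
by rewrite mul1r (absvV absv) (absvX absv) absCp_natr_ndvd// expr1n invr1.
Qed.

Lemma chi_case (P : C -> Prop) j :
  P 0 -> (~~ (p %| j)%N -> P 1) -> P (chi j).
Proof. by rewrite /chi; case: (p %| j)%N => // _; apply. Qed.

Lemma natr_shift_sub j k N :
  (j + k * p ^ N)%:R - j%:R = (k * p ^ N)%:R :> C.
Proof. by rewrite natrD addrAC subrr add0r. Qed.

Lemma absCp_shift j k N : ~~ (p %| j)%N -> v (j + k * p ^ N.+1)%:R = 1.
Proof.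
by move=> pj; rewrite absCp_natr_ndvd// dvdn_addl// expnS mulnCA dvdn_mulr.
Qed.

Lemma chiV_lip n : padic_lip 1 (chiV n).
Proof.
move=> N j k; rewrite mul1r /chiV chi_shift -mulrBr.
apply: (@chi_case (fun c => v (c * _) <= _)) => [|pj].
  by rewrite mul0r (absv0 absv) invpX_ge0.
have x1 := absCp_natr_ndvd pj; have y1 := absCp_shift k N pj.
rewrite mul1r -!exprVn (le_trans (absCp_exprB_le _ _ _))//.
- by rewrite (absvV absv) x1 invr1.
- by rewrite (absvV absv) y1 invr1.
- by rewrite absCp_invB// natr_shift_sub absCp_natrM_le.
Qed.

Lemma chiV_diff n : padic_diff 1 (chiV n) (fun j => - n%:R * chiV n.+1 j).
Proof.
move=> N j k; rewrite mul1r /chiV chi_shift.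
rewrite (_ : _ - _ = chi j * ((j + k * p ^ N.+1)%:R ^- n - j%:R ^- n +
    n%:R * (k * p ^ N.+1)%:R * j%:R ^- n.+1)); last by ring.
apply: (@chi_case (fun c => v (c * _) <= _)) => [|pj].
  by rewrite mul0r (absv0 absv) exprn_ge0 ?invpX_ge0.
have x1 := absCp_natr_ndvd pj; have y1 := absCp_shift k N pj.
rewrite mul1r -!exprVn -(natr_shift_sub j).
rewrite (le_trans (absCp_exprV_taylor _ _ _))// natr_shift_sub.
by rewrite lerXn2r ?nnegrE ?(absv_ge0 absv) ?invpX_ge0 ?absCp_natrM_le.
Qed.

(** Value bound, Lipschitz and expansion constants are all 1 whatever n, so the rate is uniform in
    n. *)
Lemma vavg_chiV n :
  vcvg v (vavg (chiV n)) (vlim v (vavg (chiV n))) /\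
  forall N, v (vavg (chiV n) N.+1 - vlim v (vavg (chiV n))) <= 2 * q ^+ N.
Proof.
have := @vavg_cvg 1 (chiV n) (fun j => - n%:R * chiV n.+1 j) ler01 (@chiV_diff n).
rewrite mulr1; apply=> [N j k|].
  rewrite -mulrBr (absvM absv) (absvN absv) (le_trans _ (chiV_lip n.+1 N j k))//.
  by rewrite ler_piMl ?(absv_ge0 absv) ?absCp_natr_le1.
apply: (absv_sum_le absv ultra) => // j _ _.
rewrite (absvM absv) (absvN absv) mulr_ile1 ?(absv_ge0 absv) ?absCp_natr_le1//.
exact: absCp_chiV_le1.
Qed.

(** The limit is close to the average at level 1, which is p^-1 times a sum of terms of absolute
    value at most 1. *)
Lemma absCp_vlim_chiV n : v (vlim v (vavg (chiV n))) <= p%:R.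
Proof.
have p2 : 2 <= p%:R :> R by rewrite ler_nat prime_gt1.
rewrite -(subrK (vavg (chiV n) 1) (vlim _ _)) (absvD_le ultra)//.
  by rewrite (absvB absv) (le_trans ((vavg_chiV n).2 0%N))// expr0 mulr1.
rewrite /vavg !expr1 expn1 (absvM absv) (absvV absv) absCp_p invrK.
rewrite ler_piMr// (absv_sum_le absv ultra)// => j _ _; exact: absCp_chiV_le1.
Qed.

(** * Volkenborn integrals as limits of averages *)

Lemma indic_padic_units j : \1_(@padic_units R p C) j%:R = chi j.
Proof.
have jE i : Qpbar_to_Cp C (Qp_to_Qpbar C i%:R) = i%:R by rewrite !rmorph_nat.
have absQ i : absQp (i%:R : Qp C) = v i%:R by rewrite -jE absCp_Qp.
rewrite indicE /chi; congr (nat_of_bool _)%:R.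
apply/idP/idP => [|pj].
  rewrite inE => -[_ [_ [b <- b1] jb]]; apply/negP => pj.
  have := absv1 absv; rewrite -jb (absvM absv) absCp_Qp => /eqP.
  rewrite lt_eqF// (le_lt_trans (ler_piMr (absv_ge0 absv _) b1))//.
  by rewrite (le_lt_trans (absCp_natr_dvd pj))// invp_lt1.
rewrite inE; split; first by exists j%:R; rewrite ?absQ ?absCp_natr_le1.
exists j%:R^-1.
  exists (j%:R^-1 : Qp C); first by rewrite !fmorphV jE.
  by rewrite -absCp_Qp !fmorphV jE (absvV absv) absCp_natr_ndvd// invr1.
by rewrite mulfV// natr_gt0_neq0// lt0n; apply: contraNneq pj => ->.
Qed.

Lemma volkenbornE (g : C -> C) (f : nat -> C) :
  (forall j, g j%:R = f j) -> volkenborn g = vlim v (vavg f).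
Proof.
move=> gf; congr vlim; apply/funext => N; congr (_ * _).
by apply: eq_bigr => j _; rewrite gf.
Qed.

Lemma lambdaSE n : @lambdaS R p C n = vlim v (vavg (chiV n)).
Proof. by apply: volkenbornE => j; rewrite indic_padic_units. Qed.

(** * The Iwasawa logarithm and its averages *)

Section Logarithm.
Context (logp : C -> C) (hlog : iwasawa_log logp).

Lemma iwasawa_logM x y : x != 0 -> y != 0 -> logp (x * y) = logp x + logp y.
Proof. by case: hlog => + _ _; apply. Qed.

Lemma iwasawa_log1 : logp 1 = 0.
Proof.
have := @iwasawa_logM 1 1 (oner_neq0 _) (oner_neq0 _).
by rewrite mulr1 => /eqP; rewrite -subr_eq0 opprD addrA subrr sub0r oppr_eq0 => /eqP.
Qed.

Lemma iwasawa_logN x : x != 0 -> logp (- x) = logp x.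
Proof.
have N1 : -1 != 0 :> C by rewrite oppr_eq0 oner_neq0.
move=> x0; rewrite -mulN1r iwasawa_logM// [logp (-1)](_ : _ = 0) ?add0r//.
have := iwasawa_logM N1 N1; rewrite mulrNN mulr1 iwasawa_log1 -mulr2n -mulr_natl.
by move=> /esym/eqP; rewrite mulf_eq0 (negbTE (natrS_neq0 1)) => /eqP.
Qed.

Lemma absCp_log_term u n :
  v ((-1) ^+ n * u ^+ n.+1 / n.+1%:R) <= v u * (n.+1%:R * v u ^+ n).
Proof.
rewrite !(absvM absv) !(absvX absv) (absvN absv) (absv1 absv) expr1n mul1r.
rewrite exprS -mulrA ler_wpM2l ?(absv_ge0 absv)// mulrC ler_wpM2r//.
  by rewrite exprn_ge0 ?(absv_ge0 absv).
exact: absCp_natrV.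
Qed.

Lemma iwasawa_log1p u : v u < 1 ->
  vcvg v (series (fun n => (-1) ^+ n * u ^+ n.+1 / n.+1%:R)) (logp (1 + u)).
Proof.
case: hlog => _ /(_ (1 + u)) + _.
by rewrite addrAC subrr add0r; apply.
Qed.

(** After the first term u, the series has terms of size at most |u|^2 (n + 2) |u|^n, and |u| <= 1/2
    makes (n + 2) |u|^n at most 2. *)
Lemma absCp_log1p_sub u : v u <= q -> v (logp (1 + u) - u) <= 2 * v u ^+ 2.
Proof.
move=> uq; have u0 := absv_ge0 absv u.
have u12 : v u <= 2^-1 by rewrite (le_trans uq) ?invp_le_half.
(* The shift makes every partial sum nonempty, so that its first term can be split off. *)
have /iwasawa_log1p/(proj2 (vcvg_shift _ _ _)) : v u < 1 by lra.
move=> /(vcvg_bound absv); apply=> M.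
rewrite /series/= big_nat_recl//= expr0 mul1r expr1 divr1 addrAC subrr add0r.
apply: (absv_sum_le absv ultra) => [|n _ _]; first by rewrite mulr_ge0 ?exprn_ge0.
apply: le_trans (absCp_log_term _ _) _.
rewrite (_ : _ * _ = v u ^+ 2 * (n.+2%:R * v u ^+ n)); last by rewrite exprS; ring.
rewrite [2 * _]mulrC ler_wpM2l ?exprn_ge0//.
have half01 : 0 <= (2^-1 : R) <= 1 by lra.
apply: (@le_trans _ _ (n.+2%:R * 2^-1 ^+ n)).
  by rewrite ler_wpM2l// lerXn2r ?nnegrE ?invr_ge0.
rewrite (_ : _ * _ = 2 * ((n%:R * (1 - 2^-1) + 1) * 2^-1 ^+ n)); last first.
  by rewrite -addn2 natrD mulrA; congr (_ * _); field.
by rewrite ler_piMr// natr_expr_le.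
Qed.

Definition chi_log (j : nat) : C := chi j * logp j%:R.

Lemma iwasawa_log_shift x y : v x = 1 -> v (y - x) < 1 ->
  logp y = logp x + logp (1 + (y - x) / x).
Proof.
move=> x1 xy.
have x0 : x != 0 by rewrite -(absv_eq0 absv) x1 oner_eq0.
have -> : 1 + (y - x) / x = y / x by field.
have y0 : y != 0.
  by apply: contraTneq xy => ->; rewrite sub0r (absvN absv) x1 ltxx.
by rewrite -iwasawa_logM ?mulf_neq0 ?invr_eq0// mulrC divfK.
Qed.

(** The derivative of log is 1/j, and the constant 2 is that of [absCp_log1p_sub] at u = d / j. *)
Lemma chi_log_diff : padic_diff 2 chi_log (chiV 1).
Proof.
move=> N j k; rewrite /chi_log /chiV chi_shift expr1.
set y := (_ + _)%:R; set d := (k * _)%:R.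
rewrite (_ : _ - _ = chi j * (logp y - logp j%:R - d / j%:R)); last by ring.
apply: (@chi_case (fun c => v (c * _) <= _)) => [|pj].
  by rewrite mul0r (absv0 absv) mulr_ge0 ?exprn_ge0 ?invpX_ge0.
have x1 := absCp_natr_ndvd pj.
have dq : v d <= q ^+ N.+1 by rewrite absCp_natrM_le.
have dq1 : v d <= q by rewrite (le_trans dq)// exprS ler_piMr ?invp_ge0 ?invpX_le1.
have dE : y - j%:R = d by rewrite natr_shift_sub.
rewrite mul1r (@iwasawa_log_shift j%:R y) ?dE ?(le_lt_trans dq1) ?invp_lt1//.
rewrite [logp j%:R + _]addrC addrK.
have vd : v (d / j%:R) = v d by rewrite (absvM absv) (absvV absv) x1 invr1 mulr1.
apply: le_trans (absCp_log1p_sub _) _; rewrite vd// ler_wpM2l//.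
by rewrite lerXn2r ?nnegrE ?(absv_ge0 absv) ?invpX_ge0.
Qed.

Lemma chi_log_lip : padic_lip 2 chi_log.
Proof.
move=> N j k.
rewrite -(subrK ((k * p ^ N.+1)%:R * chiV 1 j) (_ - _)) (absvD_le ultra)//.
  rewrite (le_trans (chi_log_diff N j k))// ler_wpM2l// expr2.
  by rewrite ler_piMl ?invpX_ge0 ?invpX_le1.
rewrite (absvM absv) -[leRHS]mulr1 ler_pM ?(absv_ge0 absv) ?absCp_chiV_le1//.
by rewrite (le_trans (absCp_natrM_le k N.+1))// ler_peMl ?invpX_ge0 ?ler1n.
Qed.

Lemma vavg_chi_log :
  vcvg v (vavg chi_log) (vlim v (vavg chi_log)).
Proof.
apply: (proj1 (@vavg_cvg 2 chi_log (chiV 1) _ chi_log_diff _ _)) => //.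
  by move=> N j k; rewrite (le_trans (chiV_lip 1 N j k))// ler_wpM2r ?invpX_ge0 ?ler1n.
apply: (absv_sum_le absv ultra) => // j _ _.
by rewrite (le_trans (absCp_chiV_le1 1 j))// ler1n.
Qed.

(** * The averages of u (log u - 1) tend to 0 *)

Definition chi_loggamma (j : nat) : C := chi j * (j%:R * (logp j%:R - 1)).

(* As log (-1) = 0, the expansion of log (p^N - j) around j applies. *)
Lemma chi_loggamma_pair N j : (j <= p ^ N.+1)%N ->
  v (chi_loggamma j + chi_loggamma (p ^ N.+1 - j) - p%:R ^+ N.+1 * chi_log j)
    <= 2 * (q ^+ N.+1) ^+ 2.
Proof.
move=> jN; rewrite /chi_loggamma /chi_log.
have -> : chi (p ^ N.+1 - j) = chi j by rewrite /chi dvdn_subr// expnS dvdn_mulr.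
rewrite natrB// natrX; set P : C := p%:R ^+ N.+1; set x : C := j%:R.
rewrite (_ : _ - _ = chi j * (x * (logp x - 1) + (P - x) * (logp (P - x) - 1)
   - P * logp x)); last by ring.
apply: (@chi_case (fun c => v (c * _) <= _)) => [|pj].
  by rewrite mul0r (absv0 absv) mulr_ge0 ?exprn_ge0 ?invpX_ge0.
have x1 : v x = 1 by exact: absCp_natr_ndvd.
have x0 : x != 0 by rewrite -(absv_eq0 absv) x1 oner_eq0.
have P0 : v P = q ^+ N.+1 by rewrite (absvX absv) absCp_p.
have Pq : v P <= q by rewrite P0 exprS ler_piMr ?invp_ge0 ?invpX_le1.
pose u := - P / x.
have uP : v u = v P by rewrite (absvM absv) (absvV absv) x1 invr1 mulr1 (absvN absv).
have Px : logp (P - x) = logp x + logp (1 + u).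
  have xP : x - P - x = - P by ring.
  rewrite -[P - x]opprB iwasawa_logN; last first.
    apply: contraTneq Pq => /eqP; rewrite subr_eq0 => /eqP <-.
    by rewrite x1 -ltNge invp_lt1.
  by rewrite (@iwasawa_log_shift x) ?xP ?(absvN absv)// (le_lt_trans Pq) ?invp_lt1.
(* As x u = - P, the linear terms cancel and only second-order terms remain. *)
rewrite mul1r Px (_ : _ - _ = (P - x) * (logp (1 + u) - u) + P * u); last first.
  by rewrite /u; field.
rewrite -P0; apply: (absvD_le ultra).
  rewrite (absvM absv) -uP (le_trans (ler_piMl _ _))// ?(absv_ge0 absv)//.
    rewrite (absvB_le absv ultra) ?x1// (le_trans Pq) ?invp_le1//.
  by rewrite absCp_log1p_sub// uP.
by rewrite (absvM absv) uP -expr2 ler_peMl ?ler1n// exprn_ge0 ?(absv_ge0 absv).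
Qed.

(** Pairing j with p^N - j turns twice the sum into p^N times the sum of log, up to second order.
    Division by p^N leaves the sum of log without its averaging factor, which tends to 0 by
    [padic_lip_sum]. *)
Lemma vavg_chi_loggamma : vcvg v (vavg chi_loggamma) 0.
Proof.
(* [B] dominates both the Lipschitz constant of [chi_log] and its sum over j < p, as [padic_lip_sum]
   asks. *)
pose B := 2 + v (\sum_(0 <= j < p) chi_log j).
have B2 : 2 <= B by rewrite lerDl (absv_ge0 absv).
have B0 : 0 <= B by rewrite (le_trans _ B2).
apply: (proj1 (vcvg_shift _ _ _)).
apply: (vcvg_le absv) (cvg_invpX (2 * B)) => N; rewrite subr0.
have F0 : chi_loggamma 0 = 0 by rewrite /chi_loggamma mul0r mulr0.
have l0 : chi_log 0 = 0 by rewrite /chi_log /chi dvdn0 mul0r.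
have pN0 : (0 < p ^ N.+1)%N by rewrite expn_gt0 prime_gt0.
set P : C := p%:R ^+ N.+1.
have vP : v P = q ^+ N.+1 by rewrite (absvX absv) absCp_p.
have P0 : P != 0 by rewrite expf_neq0// natr_gt0_neq0// prime_gt0.
have E : v (2%:R * \sum_(0 <= j < p ^ N.+1) chi_loggamma j
    - P * \sum_(0 <= j < p ^ N.+1) chi_log j) <= 2 * (q ^+ N.+1) ^+ 2.
  (* The index 0, whose partner p^N.+1 is out of range, contributes 0 and is removed before the sum
     is reversed. *)
  rewrite !(@big_ltn _ _ _ 0)// F0 l0 !add0r mulr_natl mulr2n.
  rewrite [X in _ + X - _]big_nat_rev/= -big_split/= mulr_sumr -sumrB.
  apply: (absv_sum_le absv ultra) => [|j + _].
    by rewrite mulr_ge0 ?exprn_ge0 ?invp_ge0.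
  rewrite mem_index_iota add1n subSS => /andP[_ /ltnW jN]; exact: chi_loggamma_pair.
have L : v (\sum_(0 <= j < p ^ N.+1) chi_log j) <= B * q ^+ N.
  apply: padic_lip_sum => //; last by rewrite lerDr.
  by move=> M j k; rewrite (le_trans (chi_log_lip M j k))// ler_wpM2r ?invpX_ge0.
have -> : vavg chi_loggamma N.+1 = 2%:R^-1 * (P^-1 *
   (2%:R * (\sum_(0 <= j < p ^ N.+1) chi_loggamma j)
   - P * \sum_(0 <= j < p ^ N.+1) chi_log j)
   + \sum_(0 <= j < p ^ N.+1) chi_log j).
  by rewrite /vavg -/P; field; rewrite P0 natrS_neq0.
rewrite (absvM absv) -mulrA ler_pM ?(absv_ge0 absv) ?(absCp_natrV 1)//.
apply: (absvD_le ultra) => //.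
rewrite (absvM absv) (absvV absv) vP ler_pdivrMl ?exprn_gt0 ?invp_gt0//.
apply: le_trans E _; rewrite expr2 mulrCA ler_wpM2l ?invpX_ge0//.
by rewrite exprS mulrA ler_wpM2r ?invpX_ge0//; have := invp_le1; have := invp_ge0; nra.
Qed.

(** * The power series of (1 + u) log (1 + u) - u *)

(* Abel-type identity behind the primitive of log (1 + u), on partial sums. *)
Lemma log1p_series_sum (u : C) M :
  \sum_(0 <= n < M) (-1) ^+ n * u ^+ n.+2 / (n.+1 * n.+2)%:R =
  (1 + u) * \sum_(0 <= n < M.+1) (-1) ^+ n * u ^+ n.+1 / n.+1%:R
    + (- u - (-1) ^+ M * u ^+ M.+2 / M.+1%:R).
Proof.
elim: M => [|M IH].
  by rewrite big_nil big_nat1 !expr0 expr1 !divr1 expr2; ring.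
rewrite big_nat_recr//= IH [in RHS]big_nat_recr//= !exprS natrM.
have := natrS_neq0 M; have := natrS_neq0 M.+1.
rewrite -[M.+2%:R]natr1; move: M.+1%:R => t a b.
by field; rewrite ?a ?b.
Qed.

Lemma log1p_series u : v u < 1 ->
  vcvg v (series (fun n => (-1) ^+ n * u ^+ n.+2 / (n.+1 * n.+2)%:R))
    ((1 + u) * logp (1 + u) - u).
Proof.
(* The added 0 is the limit of the boundary term of [log1p_series_sum]. *)
move=> u1; rewrite -[- u]addr0.
rewrite (_ : series _ = fun M =>
  (1 + u) * \sum_(0 <= n < M.+1) (-1) ^+ n * u ^+ n.+1 / n.+1%:R
    + (- u + - u * ((-1) ^+ M * u ^+ M.+1 / M.+1%:R))); last first.
  apply/funext => M; rewrite /series/= log1p_series_sum; congr (_ + (_ + _)).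
  by rewrite exprS; ring.
apply: (vcvgD absv).
  apply: (vcvgZ absv).
  exact: (proj2 (vcvg_shift _ _ _) (iwasawa_log1p u1)).
apply: (vcvgD absv); first exact: (vcvg_cst absv).
rewrite -[X in vcvg _ _ X](mulr0 (- u)); apply: (vcvgZ absv).
apply: (vcvg_le absv (b := fun n => v u * (n.+1%:R * v u ^+ n))) => [n|].
  by rewrite subr0 absCp_log_term.
rewrite -[X in _ --> X](mulr0 (v u)); apply: cvgMr.
by apply: cvg_natr_expr; rewrite u1 (absv_ge0 absv).
Qed.

(** * The expansion on the open unit ball *)

Section Ball.
Context (x : C) (x1 : v x < 1).

(** The factor of [lambdaS n.+1] in the Morita series, kept apart because the averages of j^(-n-1)
    carry the same factor. *)
Definition log_coef n : C := (-1) ^+ n.+2 / (n.+1 * n.+2)%:R * x ^+ n.+2.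

Lemma absCp_log_coef n : v (log_coef n) <= 2 * (n.+1%:R * v x ^+ n).
Proof.
have x0 := absv_ge0 absv x.
rewrite /log_coef 2!(absvM absv) !(absvX absv) (absvN absv) (absv1 absv) expr1n mul1r.
rewrite mulrA ler_pM ?exprn_ge0 ?(absv_ge0 absv)//.
  (* Partial fractions keep the bound linear in n, where bounding the two factors separately would
     make it quadratic. *)
  have -> : (n.+1 * n.+2)%:R^-1 = n.+1%:R^-1 - n.+2%:R^-1 :> C.
    have := natrS_neq0 n; have := natrS_neq0 n.+1.
    rewrite natrM -[n.+2%:R]natr1; move: n.+1%:R => t a b; by field; rewrite a b.
  apply: (absvB_le absv ultra); apply: le_trans (absCp_natrV _) _;
    by rewrite -natrM ler_nat; lia.
by rewrite -addn2 exprD ler_piMr ?exprn_ge0// exprn_ile1// ltW.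
Qed.

Lemma absCp_log_coef_bound n : v (log_coef n) <= 2 * (1 - v x)^-1.
Proof.
rewrite (le_trans (absCp_log_coef n))// ler_wpM2l// natrS_expr_le//.
by rewrite x1 (absv_ge0 absv).
Qed.

(** In an ultrametric complete field this makes the Morita series converge, so that its [vlim] is a
    genuine limit and not the default 0. *)
Lemma vcvg_log_coef_lambda :
  vcvg v (fun n => log_coef n * lambdaS C n.+1) 0.
Proof.
apply: (vcvg_le absv (b := fun n => p%:R * 2 * (n.+1%:R * v x ^+ n))) => [n|].
  rewrite subr0 (absvM absv) mulrC -mulrA ler_pM ?(absv_ge0 absv)//.
    by rewrite lambdaSE absCp_vlim_chiV.
  exact: absCp_log_coef.
rewrite -[X in _ --> X](mulr0 (p%:R * 2)); apply: cvgMr.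
by apply: cvg_natr_expr; rewrite x1 (absv_ge0 absv).
Qed.

Definition log_rem j : C :=
  chi j * ((x + j%:R) * (logp (x + j%:R) - 1) - j%:R * (logp j%:R - 1)
           - x * logp j%:R).

(** With u = x / j and p not dividing j, the remainder is j ((1 + u) log (1 + u) - u). *)
Lemma log_rem_series j :
  vcvg v (fun M => \sum_(0 <= n < M) log_coef n * chiV n.+1 j) (log_rem j).
Proof.
rewrite /log_rem.
rewrite (_ : (fun M => _) = fun M => chi j * \sum_(0 <= n < M)
    log_coef n / j%:R ^+ n.+1); last first.
  apply/funext => M; rewrite mulr_sumr; apply: eq_bigr => n _.
  by rewrite /chiV; ring.
rewrite /chi; case: (boolP (p %| j)%N) => pj.
  by under eq_fun do rewrite mul0r; rewrite mul0r; apply: (vcvg_cst absv).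
have j1 := absCp_natr_ndvd pj.
have j0 : j%:R != 0 :> C by rewrite -(absv_eq0 absv) j1 oner_eq0.
have xj : x + j%:R - j%:R = x by rewrite addrK.
rewrite (@iwasawa_log_shift j%:R (x + j%:R)) ?xj//; set u := x / j%:R.
have u1 : v u < 1 by rewrite (absvM absv) (absvV absv) j1 invr1 mulr1.
rewrite (_ : 1 * _ = j%:R * ((1 + u) * logp (1 + u) - u)); last first.
  by rewrite /u; field.
rewrite (_ : (fun M => _) = fun M => j%:R * \sum_(0 <= n < M)
    ((-1) ^+ n * u ^+ n.+2 / (n.+1 * n.+2)%:R)); last first.
  apply/funext => M; rewrite mul1r mulr_sumr; apply: eq_bigr => n _.
  rewrite /log_coef /u expr_div_n !exprS natrM; field.
  by rewrite expf_neq0// j0 nat1r -natrD add2n !natrS_neq0.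
exact (vcvgZ absv j%:R (log1p_series u1)).
Qed.

Lemma vavg_log_rem :
  vcvg v (vavg log_rem) (vlim v (series (fun n => log_coef n * lambdaS C n.+1))).
Proof.
have [_ _ _ cC] := Cp_completion C.
have sl := ultra_series_cvg absv ultra cC vcvg_log_coef_lambda.
set s := vlim _ _ in sl *.
have A0 : 0 <= (1 - v x)^-1 by rewrite invr_ge0 subr_ge0 ltW.
apply: (proj1 (vcvg_shift _ _ _)).
apply: (vcvg_le absv) (cvg_invpX (2 * (1 - v x)^-1 * 2)) => N.
(* At a fixed level the average is a finite sum, so it commutes with the series. *)
have wN : vcvg v (fun M => \sum_(0 <= n < M) log_coef n * vavg (chiV n.+1) N.+1)
    (vavg log_rem N.+1).
  rewrite (_ : (fun M => _) = fun M => (p%:R ^+ N.+1)^-1 *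
      \sum_(0 <= j < p ^ N.+1) \sum_(0 <= n < M) log_coef n * chiV n.+1 j).
    apply: (vcvgZ absv); apply: (vcvg_sum absv) => j _; exact: log_rem_series.
  apply/funext => M; rewrite exchange_big/= mulr_sumr; apply: eq_bigr => n _.
  by rewrite -mulr_sumr /vavg mulrCA.
(* The partial sums of the two series differ by at most their largest termwise difference, a bound
   independent of M that passes to the limit. *)
have := vcvgD absv wN (vcvgZ absv (-1) sl).
rewrite mulN1r => /(vcvg_bound absv) wB.
rewrite -[X in v X]subr0; apply: wB => M.
rewrite subr0 mulN1r /series/= -sumrB.
apply: (absv_sum_le absv ultra) => [|n _ _]; first by rewrite !mulr_ge0 ?invpX_ge0.
rewrite -mulrBr (absvM absv) -[leRHS](mulrA (2 * _)) ler_pM ?(absv_ge0 absv)//.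
  exact: absCp_log_coef_bound.
by rewrite lambdaSE; apply: (vavg_chiV n.+1).2.
Qed.

Lemma LogGammap_ball : LogGammap logp x = LogGammaM_ball logp x.
Proof.
have -> : LogGammaM_ball logp x = 0 + x * vlim v (vavg chi_log)
    + vlim v (series (fun n => log_coef n * lambdaS C n.+1)).
  rewrite add0r mulrC /LogGammaM_ball; congr (_ * _ + vlim v (series _)).
    by apply: volkenbornE => j; rewrite indic_padic_units.
  by apply/funext => n; rewrite /log_coef; ring.
rewrite /LogGammap (@volkenbornE _ (fun j =>
    chi_loggamma j + x * chi_log j + log_rem j)).
  apply: (vlimE absv); rewrite (_ : vavg _ = fun N =>
    vavg chi_loggamma N + x * vavg chi_log N + vavg log_rem N).
    apply: (vcvgD absv) vavg_log_rem; apply: (vcvgD absv) vavg_chi_loggamma _.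
    exact (vcvgZ absv x vavg_chi_log).
  by apply/funext => N; rewrite /vavg !big_split/= -mulr_sumr; ring.
move=> j; rewrite indicE.
(* As |x| < 1, |x + j| is 1 when p does not divide j and less than 1 otherwise. *)
suff -> : (x + j%:R \in [set y | 1 <= v y]) = ~~ (p %| j)%N.
  by rewrite -/(chi j) /log_rem /chi_loggamma /chi_log; ring.
case: (boolP (p %| j)%N) => pj; last first.
  by rewrite mem_set//= (absvD_eq absv ultra) (absCp_natr_ndvd pj).
apply/negbTE/negP; rewrite inE/= leNgt => /negP; apply.
by rewrite (le_lt_trans (ultra _ _))// gt_max x1
  (le_lt_trans (absCp_natr_dvd pj)) ?invp_lt1.
Qed.

End Ball.

(** * Equality of the integrands on Z_p *)

Lemma padic_integersD_natr (x : C) j :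
  padic_integers x -> padic_integers (x + j%:R).
Proof.
move=> [a <- a1]; exists (a + j%:R); first by rewrite !rmorphD !rmorph_nat.
by rewrite -absCp_Qp !rmorphD !rmorph_nat (absvD_le ultra) ?absCp_Qp ?absCp_natr_le1.
Qed.

Lemma padic_unitsE (x : C) : padic_integers x -> padic_units x <-> 1 <= v x.
Proof.
move=> [a ax a1]; split=> [[_ [_ [b <- b1] xb]]|].
  rewrite -(absv1 absv) -xb (absvM absv) absCp_Qp.
  by rewrite ler_piMr ?(absv_ge0 absv).
move=> x1; split; first by exists a.
have x0 : x != 0.
  by apply: contraTneq x1 => ->; rewrite (absv0 absv) -ltNge ltr01.
exists x^-1; last by rewrite mulfV.
exists a^-1; first by rewrite !fmorphV ax.
rewrite -absCp_Qp !fmorphV ax (absvV absv) invf_le1//.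
by rewrite (lt_le_trans _ x1).
Qed.

(** The averages agree level by level, so no question of convergence arises. *)
Lemma LogGammap_Zp (x : C) :
  padic_integers x -> LogGammap logp x = LogGammaM_Zp logp x.
Proof.
move=> xZ; apply: volkenbornE => j; rewrite !indicE; congr (_ * (nat_of_bool _)%:R).
have /padic_unitsE xE := padic_integersD_natr j xZ.
by apply/idP/idP; rewrite !inE => /xE.
Qed.

End Logarithm.
End ComplexPadic.

Theorem proposition5p2 (R : realType) (p : nat) (p_pr : prime p)
    (C : complex_padic R p) (logp : C -> C) (hlog : iwasawa_log logp) :
  forall x : C,
    (padic_integers x -> LogGammap logp x = LogGammaM_Zp logp x) /\
    (ball01 x -> LogGammap logp x = LogGammaM_ball logp x).
Proof.
by move=> x; split; [exact: LogGammap_Zp | exact: LogGammap_ball].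
Qed.
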